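(* Let $n\in2(1+\mathbb{Z}_{\ge0})$. Then the following hold. (1) If $n\equiv0\pmod4$, then the values of $Q_{\frac{n-2}{2}}(s;n)$ for $s=\pm3,\pm7,\ldots,\pm(n-1)$ are $$Q_{\frac{n-2}{2}}(s;n)=\begin{cases}(n-1)! & \text{if } s=3,7,11,\ldots,n-1,\\ -(n-1)! & \text{if } s=-3,-7,-11,\ldots,-(n-1).\end{cases}$$ (2) If $n\equiv2\pmod4$, then $Q_{\frac{n-2}{2}}(s;n)=(n-1)!$ for all $s\in\mathbb{C}$.
   Context: Put $b(x)=2x(2x+1)$. $Q_0(x;y)=1$, and for $k\ge1$, $Q_k(x;y)$ is the determinant of the $k\times k$ tridiagonal matrix with diagonal entries $(y-2-4(i-1))x$ in position $(i,i)$ $(1\le i\le k)$, entries $b(i)$ in position $(i,i+1)$, and entries $-b\left(\frac{y-2i}{2}\right)$ in position $(i+1,i)$ $(1\le i\le k-1)$. *)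

(* Defs.v *)
From mathcomp Require Import all_boot all_order all_algebra.

Set Implicit Arguments.
Unset Strict Implicit.
Unset Printing Implicit Defensive.

Import GRing.Theory Num.Theory.
Local Open Scope ring_scope.

Definition b (F : numFieldType) (x : F) : F := 2%:R * x * (2%:R * x + 1).

(* Ordinals start at 0, so row i and column j below are the rows and columns
   numbered i.+1 and j.+1 in the usual 1-based convention. *)
Definition Qmx (F : numFieldType) (k : nat) (x y : F) : 'M[F]_k :=
  \matrix_(i < k, j < k)
    if j == i :> nat then (y - 2%:R - 4%:R * i%:R) * x
    else if j == i.+1 :> nat then b (i.+1%:R : F)
    else if i == j.+1 :> nat then - b ((y - 2%:R * j.+1%:R) / 2%:R)
    else 0.

Definition Q (F : numFieldType) (k : nat) (x y : F) : F := \det (Qmx k x y).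

Lemma Q0 (F : numFieldType) (x y : F) : Q 0 x y = 1.
Proof. exact: det_mx00. Qed.

(* Main.v *)
Require Import Defs.
From mathcomp Require Import all_boot all_order all_algebra.
From mathcomp Require Import reals complex.
From mathcomp Require Import ring zify.

(** Put k = (n - 2) / 2, so that n = 2 k + 2. Solving the tridiagonal system
    of Q_k row by row, starting from the value 1, produces, up to
    alternating signs, numbers u_0 = 1, u_1, ..., u_k with
      b(i+1) u_(i+1) = (2 k - 4 i) s u_i + b(k - i + 1) u_(i-1),
    and Cramer's rule gives Q_k(s; n) = b(1) ... b(k) u_k = (n - 1)! u_k
    ([Q_recurrence]). It remains to see that u_k = 1 in the cases considered.

    The recurrence says that the generating polynomial p of the u_i is killed
    by a second order operator of Heun type, singular at 0, 1, -1 and infinity,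
    and equivariant under the inversion X -> 1/X. Dividing out this symmetry
    leaves a hypergeometric operator, so in the palindromic basis
    X^l (1 + X)^(k - 2 l) the equation becomes a two-term recurrence for the
    coordinates c_l ([heun_bin_mono], [heun_genpoly]):
      (l + 1) (2 l + 3) c_(l+1) = (k - 2 l) (s - 4 l - 3) c_l.
    If this terminates within the range 2 l <= k, then p is a genuine
    palindromic solution: its coefficients of degree 0 and k are both c_0 = 1,
    hence u_k = 1. It terminates for every s when k is even (at l = k / 2),
    and for s = 4 j + 3 at l = j when 2 j <= k; these are the two parts of the
    theorem. Negative values of s follow by replacing u_i with (-1)^i u_i. *)

Set Implicit Arguments.
Unset Strict Implicit.
Unset Printing Implicit Defensive.

Import GRing.Theory Num.Theory.
Local Open Scope ring_scope.

(** * Tridiagonal determinants and recurrences *)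

(** Cramer's rule: T w is supported on the last row, so det T w = adj T (T w)
    involves a single cofactor for the first entry, and deleting the last row
    and the first column of a Hessenberg matrix leaves a triangular matrix
    whose diagonal is the superdiagonal of T. *)
Lemma det_hessenberg_solution (F : fieldType) (k : nat) (T : 'M[F]_k.+1)
    (w : 'cV[F]_k.+1) :
  (forall i j : 'I_k.+1, (i.+1 < j)%N -> T i j = 0) ->
  (forall i : 'I_k.+1, (i < k)%N -> (T *m w) i 0 = 0) ->
  \det T * w ord0 0 =
  (-1) ^+ k * (\prod_(i < k) T (lift ord_max i) (lift ord0 i)) *
  (T *m w) ord_max 0.
Proof.
move=> hT hw.
have -> : \det T * w ord0 0 = (\adj T *m (T *m w)) ord0 0.
  by rewrite mulmxA mul_adj_mx mul_scalar_mx mxE.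
rewrite mxE (bigD1 ord_max) //= big1 ?addr0; last first.
  by move=> i ni; rewrite hw ?mulr0 // ltn_neqAle -ltnS ltn_ord andbT.
congr (_ * _).
rewrite mxE /cofactor addn0; congr (_ * _).
rewrite det_trig; first by apply: eq_bigr => i _; rewrite !mxE.
by apply/is_trig_mxP => i j ij; rewrite !mxE hT // lift0 lift_max ltnS.
Qed.

Section Tridiagonal.
Variable F : numFieldType.

Lemma prod_b (k : nat) : \prod_(i < k) b (i.+1%:R : F) = ((2 * k + 1)`!)%:R.
Proof.
elim: k => [|k IH]; first by rewrite big_ord0.
rewrite big_ord_recr /= IH /b.
have -> : (2 * k.+1 + 1)%N = (2 * k + 1).+2 by lia.
by rewrite !factS !natrM -!natr1 natrD natrM; ring.
Qed.

(** The vector (-1)^i u_i solves all the rows of the matrix but the last: the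
    alternating sign reconciles the negative subdiagonal with the positive
    superdiagonal. The recurrence at i = k - 1 identifies the residue of the
    last row with (-1)^(k-1) b(k) u_k. *)
Lemma Q_recurrence (k : nat) (x : F) (u : nat -> F) :
  u 0%N = 1 ->
  (forall i, (i < k)%N ->
     b i.+1%:R * u i.+1 = (2%:R * k%:R - 4%:R * i%:R) * x * u i +
       (if i is j.+1 then b (k%:R - j%:R) * u j else 0)) ->
  Q k x (2 * k + 2)%:R = ((2 * k + 1)`!)%:R * u k.
Proof.
case: k => [|k] u0 hu; first by rewrite Q0 u0 mulr1.
pose w : 'cV[F]_k.+1 := \col_i ((-1) ^+ i * u i).
have hsub j : b (((2 * k.+1 + 2)%:R - 2%:R * j.+1%:R) / 2%:R)
    = b (k.+1%:R - j%:R) :> F.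
  by congr b; rewrite natrD natrM -(natr1 j); field.
have row_w (i : 'I_k.+1) : (Qmx k.+1 x (2 * k.+1 + 2)%:R *m w) i 0 =
    if (i < k)%N then 0 else (-1) ^+ k * (b k.+1%:R * u k.+1).
  rewrite mxE.
  (* Separate the three diagonals; each sum then has at most one term. *)
  have -> : \sum_j Qmx k.+1 x (2 * k.+1 + 2)%:R i j * w j 0 =
      \sum_(j < k.+1 | j == i :> nat)
         (2%:R * k.+1%:R - 4%:R * i%:R) * x * ((-1) ^+ j * u j) +
      \sum_(j < k.+1 | j == i.+1 :> nat) b i.+1%:R * ((-1) ^+ j * u j) +
      \sum_(j < k.+1 | i == j.+1 :> nat)
         - b (k.+1%:R - j%:R) * ((-1) ^+ j * u j).
    rewrite !(big_mkcond (fun j : 'I__ => _ == _)) -!big_split /=.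
    apply: eq_bigr => j _; rewrite !mxE -hsub natrD addrK natrM.
    have [e|] := eqVneq (j : nat) i.
      by rewrite e !(ltn_eqF (ltnSn _)) ?addr0.
    have [e|] := eqVneq (j : nat) i.+1.
      have -> : (i == j.+1 :> nat) = false by lia.
      by rewrite add0r addr0.
    by case: ifP; rewrite ?mul0r !add0r.
  have ik := ltn_ord i.
  rewrite (big_ord1_eq _ (fun j => _ * ((-1) ^+ j * u j))) ik.
  rewrite (big_ord1_eq _ (fun j => _ * ((-1) ^+ j * u j))) ltnS.
  have -> : \sum_(j < k.+1 | i == j.+1 :> nat)
       - b (k.+1%:R - j%:R) * ((-1) ^+ j * u j) =
      (-1) ^+ i * (if i : nat is j.+1 then b (k.+1%:R - j%:R) * u j else 0).
    case: (i : nat) (ik) => [|j] jk; first by rewrite big_pred0 ?mulr0.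
    under eq_bigl do rewrite eqSS eq_sym.
    rewrite (big_ord1_eq _ (fun j => - b (k.+1%:R - j%:R) * ((-1) ^+ j * u j))).
    by rewrite ltnW //; rewrite exprS; ring.
  have := hu i ik; set d := (if _ is _.+1 then _ else _) => hi.
  have {}hi : d = b i.+1%:R * u i.+1
      - (2%:R * k.+1%:R - 4%:R * i%:R) * x * u i by rewrite hi; ring.
  rewrite hi; case: ifP => ltik; first by rewrite exprS; ring.
  have -> : (i : nat) = k by lia.
  by ring.
have := @det_hessenberg_solution _ _ (Qmx k.+1 x (2 * k.+1 + 2)%:R) w.
rewrite row_w ltnn mxE expr0 u0 !mulr1 -/(Q _ _ _) => ->.
- rewrite -prod_b big_ord_recr /=.
  under eq_bigr => i _ do rewrite mxE lift0 lift_max (gtn_eqF (ltnSn _)) eqxx.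
  by rewrite -signr_odd; case: odd; rewrite /= ?expr0 ?expr1; ring.
- move=> i j ij; rewrite mxE.
  by do 3! [rewrite ifN; last lia].
- by move=> i ik; rewrite row_w ik.
Qed.

End Tridiagonal.

(** * The differential equation of the generating polynomial *)

Section GeneratingPolynomial.
Variable F : numFieldType.
Implicit Types p q : {poly F}.

(** The Euler operator X d/dX is diagonal on monomials, which avoids the
    predecessors in exponents and indices that the bare derivative brings. *)
Definition euler p : {poly F} := 'X * p^`().

Lemma coef_euler p i : (euler p)`_i = i%:R * p`_i.
Proof.
rewrite /euler coefXM; case: i => [|i] /=; first by rewrite mul0r.
by rewrite coef_deriv mulr_natl.
Qed.

Lemma eulerD p q : euler (p + q) = euler p + euler q.
Proof. by rewrite /euler derivD mulrDr. Qed.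

Lemma eulerM p q : euler (p * q) = euler p * q + p * euler q.
Proof. by rewrite /euler derivM; ring. Qed.

Lemma eulerC (c : F) : euler c%:P = 0.
Proof. by rewrite /euler derivC mulr0. Qed.

Lemma euler_nat m : euler m%:R = 0.
Proof. by rewrite -polyC_natr eulerC. Qed.

Lemma eulerX : euler 'X = 'X.
Proof. by rewrite /euler derivX mulr1. Qed.

Lemma euler_exp p m : euler (p ^+ m.+1) = m.+1%:R * (p ^+ m * euler p).
Proof. by rewrite /euler deriv_exp -[in LHS]mulr_natl; ring. Qed.

(** With E the Euler operator, this is
      2 E (2 E + 1) - s X (2 k - 4 E) - X^2 (2 k - 2 E) (2 k + 1 - 2 E),
    whose three terms give the three terms of the recurrence for Q. *)
Definition heun (k : nat) (s : F) p : {poly F} :=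
  let r := euler p in
  2%:R * (2%:R * euler r + r)
  - 'X * (s%:P * (2%:R * k%:R * p - 4%:R * r))
  - 'X^2 * (4%:R * euler r - (8%:R * k%:R + 2%:R) * r
            + 2%:R * k%:R * (2%:R * k%:R + 1) * p).

Lemma heun_lin k s (c : F) p q :
  heun k s (p + c%:P * q) = heun k s p + c%:P * heun k s q.
Proof. by rewrite /heun !(eulerD, eulerM, eulerC, mul0r, add0r); ring. Qed.

Lemma heun_coef k s p i : heun k s p = 0 ->
  b i.+1%:R * p`_i.+1 = (2%:R * k%:R - 4%:R * i%:R) * s * p`_i +
    (if i is j.+1 then b (k%:R - j%:R) * p`_j else 0).
Proof.
move=> /(congr1 (fun q => q`_i.+1)); rewrite /heun -!polyC_natr -!polyC1.
rewrite -!(polyCM, polyCD) coef0 !coefB coefXM coefXnM /=.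
rewrite !(coefCM, coefD, coefN, coef_euler) /b subn2.
by case: i => [|i] /= e; apply: subr0_eq; rewrite -[RHS]e -!natr1; ring.
Qed.

(** * Hypergeometric solution in the palindromic basis *)

Definition bin_mono (l A : nat) : {poly F} := 'X^l * ('X + 1) ^+ A.

Lemma euler_bin_mono l A :
  ('X + 1) * euler (bin_mono l A) =
  (l%:R + (l%:R + A%:R) * 'X) * bin_mono l A.
Proof.
have eX m : euler ('X^m) = m%:R * 'X^m.
  case: m => [|m]; first by rewrite (euler_nat 1) mul0r.
  by rewrite euler_exp eulerX exprSr.
have eX1 : ('X + 1) * euler (('X + 1) ^+ A) = A%:R * 'X * ('X + 1) ^+ A.
  case: A => [|A]; first by rewrite (euler_nat 1) mulr0 !mul0r.
  by rewrite euler_exp eulerD eulerX (euler_nat 1) exprS; ring.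
rewrite /bin_mono eulerM mulrDr (mulrCA _ ('X^l)) eX1 eX; ring.
Qed.

(** The Heun operator maps the palindromic X^l (1 + X)^(k - 2 l) to 1 - X
    times a combination of only two palindromic products, the second of
    which is the first one for l + 1. This is where the factor
    4 l + 3 - s comes from: it is, up to a constant,
    the residue at X = -1 of the quotient of the image by X^l (1 + X)^(k - 2 l). When k = 2 l the
    truncated exponent of the second product is harmless, its coefficient
    being 0. *)
Lemma heun_bin_mono k s l : (2 * l <= k)%N ->
  heun k s (bin_mono l (k - 2 * l)) =
  (1 - 'X) * ((2 * l * (2 * l + 1))%:R * bin_mono l (k.+1 - 2 * l)
    + (2 * (k - 2 * l))%:R * ((4 * l + 3)%:R - s%:P)
      * bin_mono l.+1 (k - 2 * l).-1).
Proof.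
move=> lk; have [A ->] : exists A, k = (A + 2 * l)%N.
  by exists (k - 2 * l)%N; lia.
rewrite addnK -addSn addnK.
(* After multiplication by (X + 1)^2, the Euler operator and its square act
   on bin_mono l A as multiplication by polynomials. *)
have nz : (('X + 1) ^+ 2 : {poly F}) != 0.
  by rewrite expf_neq0 // -size_poly_eq0 -polyC1 size_XaddC.
apply: (mulfI nz).
have hA : ('X + 1) * (A%:R * bin_mono l.+1 A.-1) = A%:R * 'X * bin_mono l A.
  case: A => [|A]; first by rewrite !mul0r mulr0.
  by rewrite /bin_mono /= !exprS; ring.
have hS : bin_mono l A.+1 = ('X + 1) * bin_mono l A.
  by rewrite /bin_mono exprS; ring.
have dX1 f : euler (('X + 1) * f) = 'X * f + ('X + 1) * euler f.
  by rewrite eulerM eulerD eulerX (euler_nat 1) addr0.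
have dlin f : euler ((l%:R + (l%:R + A%:R) * 'X) * f) =
    (l%:R + A%:R) * 'X * f + (l%:R + (l%:R + A%:R) * 'X) * euler f.
  rewrite eulerM eulerD eulerM eulerX -natrD !euler_nat.
  by rewrite mul0r !add0r.
have e1 := euler_bin_mono l A; have e2 := congr1 euler e1.
rewrite dX1 dlin in e2.
move: (bin_mono l A) (bin_mono l.+1 A.-1) hA hS e1 e2 => p q hA -> e1 e2.
rewrite /heun /=.
move: (euler p) e1 e2 => r e1; move: (euler r) => t e2.
set a : {poly F} := l%:R in e1 e2 *; set m : {poly F} := A%:R in hA e1 e2 *.
have {}e2 : ('X + 1) * t = (a + m) * 'X * p + (a + (a + m) * 'X - 'X) * r.
  by apply: (addrI ('X * r)); rewrite e2; ring.
have e3 : ('X + 1) ^+ 2 * t = ('X + 1) * ((a + m) * 'X * p)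
    + (a + (a + m) * 'X - 'X) * ((a + (a + m) * 'X) * p).
  by rewrite expr2 -mulrA e2 -e1; ring.
rewrite !(natrD, natrM) -/a -/m.
transitivity ((4%:R - 4%:R * 'X^2) * (('X + 1) ^+ 2 * t)
  + (2%:R + 4%:R * s%:P * 'X + (8%:R * (m + 2%:R * a) + 2%:R) * 'X^2)
    * (('X + 1) * (('X + 1) * r))
  - (2%:R * (m + 2%:R * a) * s%:P * 'X
     + 2%:R * (m + 2%:R * a) * (2%:R * (m + 2%:R * a) + 1) * 'X^2)
    * (('X + 1) ^+ 2 * p)); first by ring.
transitivity ((1 - 'X) * (2%:R * a * (2%:R * a + 1) * (('X + 1) ^+ 3 * p)
  + 2%:R * (4%:R * a + 3%:R - s%:P) * (('X + 1) * (('X + 1) * (m * q)))));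
  last by ring.
rewrite e3 e1 hA; ring.
Qed.

Fixpoint hyp_coef (k : nat) (s : F) (l : nat) : F :=
  if l is l'.+1 then
    (k%:R - 2%:R * l'%:R) * (s - 4%:R * l'%:R - 3%:R)
      / (l'.+1%:R * (2%:R * l'%:R + 3%:R)) * hyp_coef k s l'
  else 1.

Definition genpoly k s m : {poly F} :=
  \sum_(l < m) (hyp_coef k s l)%:P * bin_mono l (k - 2 * l).

(** The images of successive basis elements telescope, the choice of the
    coefficients cancelling all but the last boundary term; the bound on m
    allows one step past the last basis element. *)
Lemma heun_genpoly k s m : (2 * m <= k.+2)%N ->
  heun k s (genpoly k s m) =
  - ((1 - 'X) * ((hyp_coef k s m)%:P * (2 * m * (2 * m + 1))%:R
                 * bin_mono m (k.+1 - 2 * m))).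
Proof.
elim: m => [|m IH] hm.
  rewrite /genpoly big_ord0 muln0 mul0n mulr0 mul0r mulr0 oppr0.
  by rewrite /heun /euler deriv0 mulr0 deriv0; ring.
rewrite /genpoly big_ord_recr /= heun_lin IH; last lia.
rewrite heun_bin_mono; last lia.
have -> : (k.+1 - 2 * m.+1 = (k - 2 * m).-1)%N by lia.
have -> : (k%:R - 2%:R * m%:R : F) = (k - 2 * m)%:R.
  by rewrite natrB ?natrM //; lia.
set c := hyp_coef k s m.
have -> : (((k - 2 * m)%:R * (s - 4%:R * m%:R - 3%:R)
    / (m.+1%:R * (2%:R * m%:R + 3%:R)) * c)%:P * (2 * m.+1 * (2 * m.+1 + 1))%:R
   : {poly F}) = - (c%:P * (2 * (k - 2 * m))%:R * ((4 * m + 3)%:R - s%:P)).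
  rewrite -!polyC_natr -polyCB -!polyCM -polyCN; congr _%:P.
  have n1 : (m.+1%:R : F) != 0 by rewrite pnatr_eq0.
  have n2 : (2%:R * m%:R + 3%:R : F) != 0.
    by rewrite -natrM -natrD pnatr_eq0 addn3.
  have -> : (2 * m.+1 * (2 * m.+1 + 1))%:R =
      2%:R * (m.+1%:R * (2%:R * m%:R + 3%:R)) :> F.
    by rewrite -natrM -natrD -!natrM; congr _%:R; lia.
  rewrite (natrD _ (4 * m)) (natrM _ 2) (natrM _ 4).
  move: (m.+1%:R) (2%:R * m%:R + 3%:R : F) n1 n2 => d e n1 n2.
  by field; rewrite n1 n2.
ring.
Qed.

Lemma genpoly_coef0 k s m : (genpoly k s m.+1)`_0 = 1.
Proof.
rewrite coef_sum big_ord_recl /= big1 ?addr0 => [|l _].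
  rewrite coefCM /bin_mono expr0 !mul1r.
  by rewrite -horner_coef0 horner_exp !hornerE expr1n.
by rewrite coefCM /bin_mono coefXnM /= mulr0.
Qed.

(** Only l = 0 contributes: bin_mono l (k - 2 l) has degree k - l. *)
Lemma genpoly_coefk k s m : (2 * m <= k)%N -> (genpoly k s m.+1)`_k = 1.
Proof.
have sz a : size (('X + 1 : {poly F}) ^+ a) = a.+1.
  by rewrite -polyC1 -(opprK 1) polyCN size_exp_XsubC.
move=> hm; rewrite coef_sum big_ord_recl /= big1 ?addr0 => [|[l /= lm] _].
  rewrite coefCM /bin_mono expr0 !mul1r muln0 subn0.
  have : ('X + 1 : {poly F}) ^+ k \is monic.
    by rewrite monic_exp // -polyC1 monicXaddC.
  by rewrite monicE lead_coefE sz => /eqP.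
rewrite coefCM /bin_mono coefXnM; case: ifP => _; first by rewrite mulr0.
by rewrite nth_default ?mulr0 // sz /bump /=; lia.
Qed.

Lemma hyp_coef_eq0 (k : nat) (s : F) (m : nat) :
  (k%:R - 2%:R * m%:R) * (s - 4%:R * m%:R - 3%:R) = 0 ->
  hyp_coef k s m.+1 = 0.
Proof. by move=> /= ->; rewrite !mul0r. Qed.

(** The hypothesis makes the hypergeometric series stop at l = m, so that the
    generating polynomial is an exact solution of the equation. *)
Lemma Q_terminating (k : nat) (s : F) (m : nat) : (2 * m <= k)%N ->
  (k%:R - 2%:R * m%:R) * (s - 4%:R * m%:R - 3%:R) = 0 ->
  Q k s (2 * k + 2)%:R = ((2 * k + 1)`!)%:R /\
  Q k (- s) (2 * k + 2)%:R = (-1) ^+ k * ((2 * k + 1)`!)%:R.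
Proof.
move=> hm /hyp_coef_eq0 c0; pose p := genpoly k s m.+1.
have hp : heun k s p = 0.
  by rewrite heun_genpoly ?c0 ?mul0r ?mulr0 ?oppr0 //; lia.
have rec i := heun_coef i hp.
have [p0 pk] : p`_0 = 1 /\ p`_k = 1.
  by split; [apply: genpoly_coef0 | apply: genpoly_coefk].
split.
  by rewrite (Q_recurrence (u := fun i => p`_i)) ?pk ?mulr1.
rewrite (Q_recurrence (u := fun i => (-1) ^+ i * p`_i)).
- by rewrite pk mulr1 mulrC.
- by rewrite mul1r.
- move=> i _; rewrite mulrCA rec.
  by case: i => [|i]; rewrite ?exprS; ring.
Qed.

End GeneratingPolynomial.

Theorem corollary1p25 (R : realType) (n : nat)
    (hn : exists m : nat, n = (2 * (1 + m))%N) :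
  (n = 0 %[mod 4] ->
     forall j : nat, (4 * j + 3 <= n - 1)%N ->
       @Q R[i] ((n - 2) %/ 2) (4 * j + 3)%:R n%:R = ((n - 1)`!)%:R /\
       @Q R[i] ((n - 2) %/ 2) (- (4 * j + 3)%:R) n%:R = - ((n - 1)`!)%:R)
  /\
  (n = 2 %[mod 4] ->
     forall s : R[i], @Q R[i] ((n - 2) %/ 2) s n%:R = ((n - 1)`!)%:R).
Proof.
case: hn => k ->.
have -> : ((2 * (1 + k) - 2) %/ 2 = k)%N by lia.
have -> : (2 * (1 + k) - 1 = 2 * k + 1)%N by lia.
have -> : (2 * (1 + k) = 2 * k + 2)%N by lia.
split=> hk.
  move=> j hj.
  have [] := @Q_terminating R[i] k (4 * j + 3)%:R j.
  - by lia.
  - by rewrite natrD natrM; ring.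
  - move=> -> ->; split=> //.
    have ok : odd k by lia.
    by rewrite -signr_odd ok expr1 mulN1r.
move=> s; have [] // := @Q_terminating R[i] k s (k %/ 2).
- by lia.
- have e : (k = 2 * (k %/ 2))%N by lia.
  by rewrite {1}e natrM subrr mul0r.
Qed.
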